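(* Let $q\in\mathcal C^1(\mathbb R_+,\mathbb R_+)$ satisfy $q(0)=0$, $0<q(x)<x$ and $|q'(x)|<1$ for every $x>0$, and let $Q:\mathbb R_+\to\mathbb R_+$ be defined by $$Q(x)=\frac1{\sqrt2}\left[2(q+\mathrm{Id})^{-1}(\sqrt2\,x)-\sqrt2\,x\right].$$ Let $x_0>0$. (a) Assume that $q'(0)=0$ and let $F:(0,x_0]\to\mathbb R_+$ be the diffeomorphism defined by $F(z)=\int_z^{x_0}\frac{d\xi}{\overline q(\xi)}$, where $\overline q(s)=\sqrt2\,q(\sqrt2\,s)$ for $s\in\mathbb R_+$. Then $F(Q^{[n]}(x_0))\sim n$ as $n\to+\infty$. If moreover there exists $C>0$ such that $\frac{F(z)\overline q(z)}{z}\le C$ for every $z\in(0,x_0]$, then $Q^{[n]}(x_0)\sim F^{-1}(n)$ as $n\to+\infty$. (b) Assume that $q'(0)\in(0,1)$ and let $\lambda=2\,\mathrm{artanh}(q'(0))$. Then $\ln Q^{[n]}(x_0)\sim-\lambda n$ as $n\to+\infty$. If moreover $\sum_{k=0}^\infty\psi(e^{-\frac\lambda2k})<+\infty$, where $\psi(r)=\sup_{s\in(0,r]}\left|\frac{q(s)}s-q'(0)\right|$, then there exists $C>1$ such that, for every $n\in\mathbb N$, $C^{-1}e^{-\lambda n}\le Q^{[n]}(x_0)\le Ce^{-\lambda n}$. (c) If $q'(0)=1$, then for every $C>0$, $\lim_{n\to+\infty}e^{Cn}Q^{[n]}(x_0)=0$. If moreover there exist positive constants $C_*,\alpha,x_*$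 such that $C_*x_*^\alpha<1$ and $|q(x)-x|\le C_*2^{-\frac\alpha2}|x|^{1+\alpha}$ for $0\le x\le x_*$, then there exists a positive constant $\mu_*$ such that $Q^{[n]}(x_0)\le C_*^{-\frac1\alpha}e^{-\mu_*(1+\alpha)^n}$ for $n$ large enough.
   Context: $\mathbb R_+=[0,+\infty)$, $\mathbb N=\{0,1,2,\dots\}$. $\mathrm{Id}$ is the identity function; under the hypotheses $q+\mathrm{Id}$ is an increasing bijection of $\mathbb R_+$ and $Q$ satisfies $0<Q(x)<x$ for $x>0$. $Q^{[n]}$ denotes the $n$-th iterate of $Q$ under composition ($Q^{[0]}=\mathrm{Id}$). $a_n\sim b_n$ means $a_n/b_n\to1$. *)

(* Defs.v *)
From Stdlib Require Import Reals Lra ClassicalEpsilon.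
From Coquelicot Require Import Coquelicot.
Open Scope R_scope.

(** Functions on [0,+oo) are represented by total functions [R -> R]; only
    their values on [nonneg_reals] matter below. *)
Definition nonneg_reals (x : R) : Prop := 0 <= x.

(** [is_derive] relative to the domain [D]: the derivative is one-sided at a
    boundary point of [D]. *)
Definition is_derive_on (D : R -> Prop) (f : R -> R) (x l : R) : Prop :=
  filterdiff f (within D (locally x)) (fun y => scal y l).

Definition is_C1_on (D : R -> Prop) (f f' : R -> R) : Prop :=
  (forall x, D x -> is_derive_on D f x (f' x)) /\ continuous_on D f'.

(** Inverse of the restriction of [f] to [D]; a junk value outside [f(D)]. *)
Definition inv_on (D : R -> Prop) (f : R -> R) (y : R) : R :=
  epsilon (inhabits 0) (fun x => D x /\ f x = y).

Lemma inv_on_spec (D : R -> Prop) (f : R -> R) (y : R) :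
  (exists x, D x /\ f x = y) -> D (inv_on D f y) /\ f (inv_on D f y) = y.
Proof. exact (epsilon_spec (inhabits 0) (fun x => D x /\ f x = y)). Qed.

Definition Qmap (q : R -> R) (x : R) : R :=
  1 / sqrt 2 *
    (2 * inv_on nonneg_reals (fun t => q t + t) (sqrt 2 * x) - sqrt 2 * x).

Definition qbar (q : R -> R) (s : R) : R := sqrt 2 * q (sqrt 2 * s).

Definition F_int (q : R -> R) (x0 z : R) : R :=
  RInt (fun xi => 1 / qbar q xi) z x0.

Definition Finv (q : R -> R) (x0 : R) : R -> R :=
  inv_on (fun z => 0 < z <= x0) (F_int q x0).

Definition seq_equiv (a b : nat -> R) : Prop :=
  is_lim_seq (fun n => a n / b n) 1.

Definition artanh (x : R) : R := ln ((1 + x) / (1 - x)) / 2.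

Lemma tanh_artanh (x : R) : -1 < x < 1 -> tanh (artanh x) = x.
Proof.
intros Hx.
assert (Hp : 0 < (1 + x) / (1 - x)) by (apply Rdiv_lt_0_compat; lra).
unfold tanh, sinh, cosh, artanh.
set (L := ln ((1 + x) / (1 - x))).
assert (H2 : exp (L / 2) * exp (L / 2) = (1 + x) / (1 - x)).
{ rewrite <- exp_plus. replace (L / 2 + L / 2) with L by field.
  now apply exp_ln. }
rewrite exp_Ropp.
pose proof (exp_pos (L / 2)) as He.
set (e := exp (L / 2)) in *.
replace ((e - / e) / 2 / ((e + / e) / 2)) with ((e * e - 1) / (e * e + 1)).
- rewrite H2. field. lra.
- field. nra.
Qed.

(** Supremum of [|q s / s - l|] over [0 < s <= r], with [l] the derivative of
    [q] at [0].  When [0 < q s < s] the set is bounded, so that the projection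
    [real] of the least upper bound loses nothing. *)
Definition psi (q : R -> R) (l r : R) : R :=
  real (Lub_Rbar (fun y => exists s, 0 < s <= r /\ y = Rabs (q s / s - l))).

(** [x ^ a] for [x >= 0] and [a > 0]: unlike [Rpower], it vanishes at [0]. *)
Definition pow_real (x a : R) : R :=
  if Req_EM_T x 0 then 0 else Rpower x a.

(* Main.v *)
Require Import Defs.
From Stdlib Require Import Reals Lra Lia.
From Coquelicot Require Import Coquelicot.
Open Scope R_scope.

(** Write [h] for [qbar q].  Solving [q t + t = sqrt 2 * x] shows that
    [x - Q x = h ((x + Q x) / 2)]: the iterates [x n] of [Q] are those of the
    implicit midpoint rule, with step [1], for the equation [y' = - h y]
    ([Qmap_orbit]).  They decrease, and they tend to [0] because [h] has no
    other zero ([midpoint_orbit_lim]).  With [m] the midpoint of a step and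
    [r = h m / (2 * m)], which tends to [q' 0], the step multiplies [x n] by
    [(1 - r) / (1 + r)] ([orbit_ratio]).

    If [q' 0 = 0], [F] measures the time that the flow takes from [x0] to a
    point.  On the [n]-th step [h] is constant up to a factor tending to [1],
    so the step takes a time tending to [1] ([elapsed_midpoint_step]), and
    Cesaro's theorem gives [F (x n) ~ n].  The bound on [F z * h z / z] says
    that [ln F] has slope at least [1 / C] in the variable [ln z], in absolute
    value, so that an equivalence of the values of [F] yields one of the points
    ([seq_equiv_of_elapsed]).

    If [0 < q' 0 < 1], the increments of [ln (x n)] are [- 2 * artanh r]
    ([ln_orbit_step]), with limit [- lambda]; Cesaro's theorem gives the
    equivalent.  Their distance to the limit is at most a constant times
    [psi (sqrt 2 * x n)], hence eventually [psi (exp (- lambda * n / 2))] by the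
    equivalent just found ([half_slope_defect_le_psi]); when this is summable,
    [ln (x n) + lambda * n] is bounded.

    If [q' 0 = 1], the ratio of successive terms tends to [0], and so does
    [exp (C n) * x n] by the ratio test.  The estimate on [q x - x] turns
    [x (S n) = m - h m / 2] into [x (S n) <= Cs * x n ^ (1 + alpha)], a linear
    recursive inequality for [ln (x n)] ([superexponential_decay]). *)

(** * Sequences *)

Lemma is_lim_seq_of_eps (u : nat -> R) (l : R) :
  (forall eps, 0 < eps <= 1 -> eventually (fun n => Rabs (u n - l) <= eps)) ->
  is_lim_seq u l.
Proof.
intros H. apply is_lim_seq_spec. intros eps. destruct eps as [eps He]. simpl.
assert (He' : 0 < Rmin (eps / 2) 1 <= 1).
{ split; [apply Rmin_glb_lt; lra | apply Rmin_r]. }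
generalize (H _ He'). apply filter_imp. intros n Hn.
pose proof (Rmin_l (eps / 2) 1). lra.
Qed.

Lemma eventually_close (u : nat -> R) (l eps : R) :
  is_lim_seq u l -> 0 < eps -> eventually (fun n => Rabs (u n - l) < eps).
Proof.
intros H He. apply is_lim_seq_spec in H. exact (H (mkposreal eps He)).
Qed.

(** The increments average to [l] by Cesaro's theorem, and their sum telescopes
    to [u n - u 0]. *)
Lemma is_lim_seq_div_INR (u : nat -> R) (l : R) :
  is_lim_seq (fun n => u (S n) - u n) l ->
  is_lim_seq (fun n => u n / INR n) l.
Proof.
intros H. apply is_lim_seq_Reals in H. apply Cesaro_1 in H.
apply is_lim_seq_Reals in H.
assert (Htel : forall n, sum_f_R0 (fun k => u (S k) - u k) n = u (S n) - u O).
{ induction n as [|n IH]; simpl; [|rewrite IH]; ring. }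
assert (H0 : is_lim_seq (fun n => u O * / INR n) 0).
{ replace (Finite 0) with (Rbar_mult (u O) (Rbar_inv p_infty))
    by (simpl; f_equal; ring).
  apply is_lim_seq_scal_l, is_lim_seq_inv; [apply is_lim_seq_INR|easy]. }
replace (Finite l) with (Finite (l + 0)) by (f_equal; ring).
eapply is_lim_seq_ext_loc; [|exact (is_lim_seq_plus' _ _ _ _ H H0)].
exists 1%nat. intros [|n] Hn; [lia|].
simpl pred. rewrite Htel. field. apply not_0_INR. lia.
Qed.

Lemma bounded_of_ex_series_increments (u p : nat -> R) :
  eventually (fun n => Rabs (u (S n) - u n) <= p n) -> ex_series p ->
  exists M, forall n, Rabs (u n) <= M.
Proof.
intros [N HN] Hp.
assert (Hs : ex_series (fun n => u (S (N + n)) - u (N + n)%nat)).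
{ apply (ex_series_le (V := R_CompleteNormedModule)) with (b := fun n => p (N + n)%nat).
  - intros n. apply HN. lia.
  - now apply ex_series_incr_n. }
destruct Hs as [l Hl].
assert (Hu : is_lim_seq (fun n => u (n + S N)%nat) (l + u N)).
{ apply is_lim_seq_ext with
    (fun n => sum_n (fun n => u (S (N + n)) - u (N + n)%nat) n + u N).
  - induction n as [|n IH].
    + rewrite sum_O. rewrite Nat.add_0_r. simpl. ring.
    + rewrite sum_Sn. unfold plus; simpl in *.
      rewrite Rplus_assoc, (Rplus_comm _ (u N)), <- Rplus_assoc, IH.
      replace (n + S N)%nat with (N + S n)%nat by lia. ring.
  - apply is_lim_seq_plus'; [exact Hl | apply is_lim_seq_const]. }
apply is_lim_seq_incr_n in Hu.
destruct (filterlim_bounded u) as [M HM]; [now exists (l + u N)|].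
now exists M.
Qed.

(** * The implicit midpoint scheme *)

Definition midpoint (x : nat -> R) (n : nat) : R := (x n + x (S n)) / 2.

(** One step of the implicit midpoint rule, with time step [1], for the
    differential equation [y' = - h y]. *)
Definition midpoint_orbit (h : R -> R) (x : nat -> R) : Prop :=
  forall n, 0 < x n /\ x n - x (S n) = h (midpoint x n).

Definition positive_continuous (h : R -> R) : Prop :=
  forall s, 0 < s -> 0 < h s /\ continuous h s.


Lemma midpoint_between (h : R -> R) (x : nat -> R) (n : nat) :
  positive_continuous h -> midpoint_orbit h x ->
  0 < x (S n) < midpoint x n /\ midpoint x n < x n.
Proof.
intros Hh Hx. destruct (Hx n) as [H0 H1], (Hx (S n)) as [H2 _].
assert (Hm : 0 < midpoint x n) by (unfold midpoint; lra).
destruct (Hh _ Hm) as [H3 _]. unfold midpoint in *. lra.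
Qed.

(** A positive limit [l] would be a zero of the speed [h]. *)
Lemma midpoint_orbit_lim (h : R -> R) (x : nat -> R) :
  positive_continuous h -> midpoint_orbit h x -> is_lim_seq x 0.
Proof.
intros Hh Hx.
destruct (ex_finite_lim_seq_decr x 0) as [l Hl].
{ intros n. destruct (midpoint_between h x n Hh Hx). lra. }
{ intros n. apply Rlt_le, Hx. }
assert (Hl0 : 0 <= l).
{ apply (is_lim_seq_le (fun _ => 0) x 0 l); [|apply is_lim_seq_const|exact Hl].
  intros n. apply Rlt_le, Hx. }
destruct Hl0 as [Hpos|<-]; [exfalso|exact Hl].
pose proof Hl as HlS. apply is_lim_seq_incr_1 in HlS.
assert (Hm : is_lim_seq (midpoint x) l).
{ replace (Finite l) with (Finite ((l + l) * / 2)) by (f_equal; field).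
  apply is_lim_seq_mult'; [|apply is_lim_seq_const].
  now apply is_lim_seq_plus'. }
destruct (Hh l Hpos) as [Hhl Hc].
assert (H1 : is_lim_seq (fun n => h (midpoint x n)) (h l)).
{ apply is_lim_seq_continuous; [|exact Hm].
  now apply continuity_pt_filterlim. }
assert (H2 : is_lim_seq (fun n => h (midpoint x n)) (l - l)).
{ apply is_lim_seq_ext with (fun n => x n - x (S n)); [apply Hx|].
  now apply is_lim_seq_minus'. }
apply is_lim_seq_unique in H1. apply is_lim_seq_unique in H2.
rewrite H1 in H2. injection H2. lra.
Qed.

Lemma midpoint_at_right (h : R -> R) (x : nat -> R) :
  positive_continuous h -> midpoint_orbit h x ->
  filterlim (midpoint x) eventually (at_right 0).
Proof.
intros Hh Hx P [d Hd]. unfold filtermap.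
pose proof (midpoint_orbit_lim h x Hh Hx) as Hl.
generalize (eventually_close _ _ d Hl (cond_pos d)).
apply filter_imp. intros n Hn. destruct (midpoint_between h x n Hh Hx).
apply Hd; [|lra].
change (Rabs (midpoint x n - 0) < d).
rewrite Rminus_0_r in *. rewrite Rabs_right in *; lra.
Qed.

(** * Elapsed time along the flow *)

(** Time at which the solution of [y' = - h y] starting at [x0] reaches [z]. *)
Definition elapsed (h : R -> R) (x0 z : R) : R := RInt (fun xi => 1 / h xi) z x0.

Lemma continuous_inv_speed (h : R -> R) (s : R) :
  positive_continuous h -> 0 < s -> continuous (fun xi => 1 / h xi) s.
Proof.
intros Hh Hs. destruct (Hh s Hs) as [H1 H2].
apply continuous_ext with (fun xi => / h xi); [intros; now rewrite <- Rdiv_1_l|].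
apply continuous_Rinv_comp; [exact H2|lra].
Qed.

Lemma ex_RInt_inv_speed (h : R -> R) (a b : R) :
  positive_continuous h -> 0 < a -> 0 < b -> ex_RInt (fun xi => 1 / h xi) a b.
Proof.
intros Hh Ha Hb. apply (ex_RInt_continuous (V := R_CompleteNormedModule)).
intros z Hz. apply continuous_inv_speed; [exact Hh|].
assert (0 < Rmin a b) by now apply Rmin_glb_lt. lra.
Qed.

Lemma elapsed_minus (h : R -> R) (x0 u w : R) :
  positive_continuous h -> 0 < x0 -> 0 < u -> 0 < w ->
  elapsed h x0 u - elapsed h x0 w = RInt (fun xi => 1 / h xi) u w.
Proof.
intros Hh H0 Hu Hw. unfold elapsed.
rewrite <- (RInt_Chasles (fun xi => 1 / h xi) u w x0)
  by now apply ex_RInt_inv_speed.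
unfold plus; simpl. ring.
Qed.

Lemma elapsed_decr (h : R -> R) (x0 u w : R) :
  positive_continuous h -> 0 < x0 -> 0 < u <= w ->
  elapsed h x0 w <= elapsed h x0 u.
Proof.
intros Hh H0 Hu.
enough (0 <= elapsed h x0 u - elapsed h x0 w) by lra.
rewrite elapsed_minus by (assumption || lra).
apply RInt_ge_0; [lra|apply ex_RInt_inv_speed; [assumption|lra|lra]|].
intros s Hs. apply Rlt_le, Rdiv_lt_0_compat; [lra|]. apply Hh. lra.
Qed.

Lemma elapsed_refl (h : R -> R) (x0 : R) : elapsed h x0 x0 = 0.
Proof. apply (RInt_point (V := R_CompleteNormedModule)). Qed.

(** Near [0] the speed is almost constant over a step, relatively to its value
    at the midpoint, because its oscillation is at most a small multiple of the
    length of the step, which is that value.  Hence a step takes a time close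
    to [1]. *)
Lemma elapsed_midpoint_step (h : R -> R) (x : nat -> R) (x0 : R) :
  positive_continuous h -> midpoint_orbit h x -> 0 < x0 ->
  (forall eps, 0 < eps -> exists d, 0 < d /\
     forall s t, 0 < s < d -> 0 < t < d -> Rabs (h s - h t) <= eps * Rabs (s - t)) ->
  is_lim_seq (fun n => elapsed h x0 (x (S n)) - elapsed h x0 (x n)) 1.
Proof.
intros Hh Hx H0 Hlip. apply is_lim_seq_of_eps. intros eps He.
destruct (Hlip eps) as (d & Hd & Hosc); [lra|].
pose proof (midpoint_orbit_lim h x Hh Hx) as Hl.
generalize (eventually_close _ _ d Hl Hd). apply filter_imp. intros n Hn.
destruct (Hx n) as [Hxn Hstep].
destruct (midpoint_between h x n Hh Hx) as [Hm1 Hm2].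
rewrite Rminus_0_r, Rabs_right in Hn by lra.
rewrite elapsed_minus by (assumption || lra).
set (m := midpoint x n) in *.
assert (Hhm : 0 < h m) by (apply Hh; lra).
assert (Hpt : forall s, x (S n) < s < x n ->
  (1 - eps) / h m <= 1 / h s <= (1 + eps) / h m).
{ intros s Hs. assert (Hhs : 0 < h s) by (apply Hh; lra).
  assert (Ho : Rabs (h s - h m) <= eps * (h m / 2)).
  { eapply Rle_trans; [apply Hosc; lra|].
    apply Rmult_le_compat_l; [lra|]. apply Rabs_le.
    unfold m, midpoint in *. lra. }
  apply Rabs_le_between in Ho.
  assert (Hem : 0 <= eps * h m) by (apply Rmult_le_pos; lra).
  split; apply Rmult_le_reg_r with (h s * h m); try (apply Rmult_lt_0_compat; lra);
    field_simplify; try lra; nra. }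
assert (Hc : forall c, RInt (fun _ => c / h m) (x (S n)) (x n) = c).
{ intros c. rewrite RInt_const. unfold scal; simpl; unfold mult; simpl.
  rewrite Hstep. field. lra. }
assert (Hi : ex_RInt (fun xi => 1 / h xi) (x (S n)) (x n))
  by (apply ex_RInt_inv_speed; [assumption|lra|lra]).
apply Rabs_le. split.
- enough (1 - eps <= RInt (fun xi => 1 / h xi) (x (S n)) (x n)) by lra.
  rewrite <- (Hc (1 - eps)) at 1.
  apply RInt_le; [lra|apply ex_RInt_const|exact Hi|]. intros s Hs. now apply Hpt.
- enough (RInt (fun xi => 1 / h xi) (x (S n)) (x n) <= 1 + eps) by lra.
  rewrite <- (Hc (1 + eps)).
  apply RInt_le; [lra|exact Hi|apply ex_RInt_const|]. intros s Hs. now apply Hpt.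
Qed.

(** The hypothesis says that [1 / h s >= elapsed s / (C s)], where
    [elapsed s >= elapsed w] to the left of [w]; integrate this over [[u, w]]. *)
Lemma elapsed_ge_ln (h : R -> R) (x0 C u w : R) :
  positive_continuous h -> 0 < C ->
  (forall z, 0 < z <= x0 -> elapsed h x0 z * h z / z <= C) ->
  0 < u <= w -> w <= x0 ->
  elapsed h x0 w * (ln w - ln u) <= C * (elapsed h x0 u - elapsed h x0 w).
Proof.
intros Hh HC Hbd Hu Hw.
rewrite elapsed_minus by (assumption || lra).
set (E := elapsed h x0 w).
assert (HR : is_RInt (fun s => E / C * / s) u w (E / C * (ln w - ln u))).
{ apply (is_RInt_scal (V := R_NormedModule)).
  apply (is_RInt_derive (V := R_CompleteNormedModule) ln Rinv);
    rewrite Rmin_left, Rmax_right by lra; intros s Hs.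
  - apply is_derive_Reals, derivable_pt_lim_ln. lra.
  - apply continuous_Rinv. lra. }
pose proof (is_RInt_unique _ _ _ _ HR) as HRv.
apply Rmult_le_reg_l with (/ C); [now apply Rinv_0_lt_compat|].
replace (/ C * (E * (ln w - ln u))) with (E / C * (ln w - ln u)) by (field; lra).
rewrite <- HRv, <- Rmult_assoc, Rinv_l, Rmult_1_l by lra.
apply RInt_le; [lra|now exists (E / C * (ln w - ln u))| |].
{ apply ex_RInt_inv_speed; [assumption|lra|lra]. }
intros s Hs.
destruct (Hh s) as [Hhs _]; [lra|].
assert (HE : E <= elapsed h x0 s) by (apply elapsed_decr; [assumption|lra|lra]).
assert (Hz : elapsed h x0 s * h s / s <= C) by (apply Hbd; lra).
assert (Hz' : elapsed h x0 s * h s <= C * s).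
{ apply Rmult_le_reg_r with (/ s); [apply Rinv_0_lt_compat; lra|].
  replace (C * s * / s) with C by (field; lra). exact Hz. }
apply Rmult_le_reg_r with (C * s * h s).
{ repeat apply Rmult_lt_0_compat; lra. }
replace (E / C * / s * (C * s * h s)) with (E * h s) by (field; lra).
replace (1 / h s * (C * s * h s)) with (C * s) by (field; lra).
eapply Rle_trans; [|exact Hz']. apply Rmult_le_compat_r; lra.
Qed.

(** Used with [x] and [y] in either order, [elapsed_ge_ln] bounds the distance
    of [ln (x n)] and [ln (y n)] by the distances to [1] of the ratio of the
    elapsed times and of its inverse. *)
Lemma seq_equiv_of_elapsed (h : R -> R) (x0 C : R) (x y : nat -> R) :
  positive_continuous h -> 0 < C ->
  (forall z, 0 < z <= x0 -> elapsed h x0 z * h z / z <= C) ->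
  (forall n, 0 < x n <= x0) -> (forall n, 0 < y n <= x0) ->
  eventually (fun n => 0 < elapsed h x0 (y n)) ->
  seq_equiv (fun n => elapsed h x0 (x n)) (fun n => elapsed h x0 (y n)) ->
  seq_equiv x y.
Proof.
intros Hh HC Hbd Hx Hy Hpos Hequiv. unfold seq_equiv in *.
set (r := fun n => elapsed h x0 (x n) / elapsed h x0 (y n)) in *.
assert (Hlim : is_lim_seq (fun n => C * (Rabs (r n - 1) + Rabs (/ r n - 1))) 0).
{ replace (Finite 0) with (Finite (C * (Rabs (1 - 1) + Rabs (/ 1 - 1)))).
  2: { f_equal. rewrite Rinv_1, Rminus_diag, Rabs_R0. ring. }
  apply is_lim_seq_mult'; [apply is_lim_seq_const|].
  apply is_lim_seq_plus'; apply (is_lim_seq_abs _ (Finite _));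
    apply is_lim_seq_minus'; try apply is_lim_seq_const; [exact Hequiv|].
  apply (is_lim_seq_inv r 1 Hequiv). intros K; injection K; lra. }
assert (Hln : is_lim_seq (fun n => ln (x n) - ln (y n)) 0).
{ apply is_lim_seq_abs_0.
  eapply is_lim_seq_le_le_loc; [|apply is_lim_seq_const|exact Hlim].
  assert (Hr : eventually (fun n => Rabs (r n - 1) < 1))
    by (apply eventually_close; [exact Hequiv|lra]).
  generalize (filter_and _ _ Hpos Hr). apply filter_imp. intros n [Hn Hrn].
  split; [apply Rabs_pos|].
  assert (Hrp : 0 < r n) by (apply Rabs_lt_between in Hrn; lra).
  assert (Hxn : 0 < elapsed h x0 (x n)).
  { replace (elapsed h x0 (x n)) with (r n * elapsed h x0 (y n))
      by (unfold r; field; lra). now apply Rmult_lt_0_compat. }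
  pose proof (Rle_abs (r n - 1)) as A1. pose proof (Rle_abs (/ r n - 1)) as A2.
  pose proof (Rabs_pos (r n - 1)) as A3. pose proof (Rabs_pos (/ r n - 1)) as A4.
  pose proof (Hx n) as Hxn'. pose proof (Hy n) as Hyn'.
  destruct (Rle_lt_dec (x n) (y n)) as [Hle|Hlt].
  - assert (Hl : ln (x n) <= ln (y n)) by (apply ln_le; lra).
    rewrite Rabs_left1 by lra.
    apply Rle_trans with (C * (r n - 1)); [|apply Rmult_le_compat_l; lra].
    apply Rmult_le_reg_l with (elapsed h x0 (y n)); [exact Hn|].
    replace (elapsed h x0 (y n) * (C * (r n - 1)))
      with (C * (elapsed h x0 (x n) - elapsed h x0 (y n))) by (unfold r; field; lra).
    replace (- (ln (x n) - ln (y n))) with (ln (y n) - ln (x n)) by ring.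
    apply elapsed_ge_ln; (assumption || lra).
  - assert (Hl : ln (y n) <= ln (x n)) by (apply ln_le; lra).
    rewrite Rabs_right by lra.
    apply Rle_trans with (C * (/ r n - 1)); [|apply Rmult_le_compat_l; lra].
    apply Rmult_le_reg_l with (elapsed h x0 (x n)); [exact Hxn|].
    replace (elapsed h x0 (x n) * (C * (/ r n - 1)))
      with (C * (elapsed h x0 (y n) - elapsed h x0 (x n))) by (unfold r; field; lra).
    apply elapsed_ge_ln; (assumption || lra). }
apply is_lim_seq_ext with (fun n => exp (ln (x n) - ln (y n))).
{ intros n. unfold Rminus. rewrite exp_plus, exp_Ropp, !exp_ln.
  - reflexivity.
  - apply Hy.
  - apply Hx. }
rewrite <- exp_0. apply is_lim_seq_continuous; [|exact Hln].
apply derivable_continuous_pt, derivable_pt_exp.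
Qed.

Lemma elapsed_surj (h : R -> R) (x0 z t : R) :
  positive_continuous h -> 0 < z < x0 -> 0 <= t <= elapsed h x0 z ->
  exists y, 0 < y <= x0 /\ elapsed h x0 y = t.
Proof.
intros Hh Hz Ht.
destruct (Ranalysis5.f_interv_is_interv (fun y => - elapsed h x0 y) z x0 (- t))
  as (y & Hy & Hty).
- lra.
- rewrite elapsed_refl. lra.
- intros y Hy. apply continuity_pt_opp, continuity_pt_filterlim.
  apply (continuous_RInt_2 (V := R_NormedModule) (fun xi => 1 / h xi) y x0).
  assert (Hy0 : 0 < y) by lra.
  exists (mkposreal y Hy0). intros s Hs. change (Rabs (s - y) < y) in Hs.
  apply Rabs_lt_between in Hs.
  apply (RInt_correct (V := R_CompleteNormedModule)).
  apply ex_RInt_inv_speed; [assumption|lra|lra].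
- exists y. split; lra.
Qed.

Lemma exp_nondecreasing (a b : R) : a <= b -> exp a <= exp b.
Proof.
intros [H|<-]; [|apply Rle_refl]. now apply Rlt_le, exp_increasing.
Qed.

(** * Contraction factor of a step *)

(** Half the slope of the line from the origin to the graph of [h] over the
    midpoint.  For [h = qbar q] it is [q t / t], with [t] equal to [sqrt 2]
    times the midpoint. *)
Definition half_slope (h : R -> R) (x : nat -> R) (n : nat) : R :=
  h (midpoint x n) / (2 * midpoint x n).

Lemma half_slope_bounds (h : R -> R) (x : nat -> R) (n : nat) :
  positive_continuous h -> midpoint_orbit h x -> 0 < half_slope h x n < 1.
Proof.
intros Hh Hx. destruct (midpoint_between h x n Hh Hx) as [[H0 H1] _].
destruct (Hh (midpoint x n)) as [H2 _]; [lra|]. unfold half_slope. split.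
- apply Rdiv_lt_0_compat; lra.
- apply Rmult_lt_reg_r with (2 * midpoint x n); [lra|].
  replace (h (midpoint x n) / (2 * midpoint x n) * (2 * midpoint x n))
    with (h (midpoint x n)) by (field; lra).
  rewrite <- (proj2 (Hx n)). unfold midpoint in *. lra.
Qed.

(** The endpoints of a step are its midpoint times [1 + half_slope] and
    [1 - half_slope]. *)
Lemma orbit_ratio (h : R -> R) (x : nat -> R) (n : nat) :
  positive_continuous h -> midpoint_orbit h x ->
  x (S n) / x n = (1 - half_slope h x n) / (1 + half_slope h x n).
Proof.
intros Hh Hx. destruct (midpoint_between h x n Hh Hx) as [[H0 H1] H2].
unfold half_slope. rewrite <- (proj2 (Hx n)). unfold midpoint in *. field. lra.
Qed.

Lemma half_slope_lim (h : R -> R) (x : nat -> R) (a : R) :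
  positive_continuous h -> midpoint_orbit h x ->
  filterlim (fun s => h s / (2 * s)) (at_right 0) (locally a) ->
  is_lim_seq (half_slope h x) a.
Proof.
intros Hh Hx Ha.
apply (filterlim_comp _ _ _ (midpoint x) (fun s => h s / (2 * s)) _ (at_right 0) _);
  [now apply (midpoint_at_right h)|exact Ha].
Qed.

Lemma orbit_ratio_lim (h : R -> R) (x : nat -> R) (a : R) :
  positive_continuous h -> midpoint_orbit h x -> 0 <= a ->
  is_lim_seq (half_slope h x) a ->
  is_lim_seq (fun n => x (S n) / x n) ((1 - a) / (1 + a)).
Proof.
intros Hh Hx Ha Hl.
apply is_lim_seq_ext with (fun n => (1 - half_slope h x n) / (1 + half_slope h x n)).
{ intros n. symmetry. now apply orbit_ratio. }
apply is_lim_seq_div'; [| |lra].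
- apply is_lim_seq_minus'; [apply is_lim_seq_const|exact Hl].
- apply is_lim_seq_plus'; [apply is_lim_seq_const|exact Hl].
Qed.

Lemma two_artanh (a : R) :
  -1 < a < 1 -> 2 * artanh a = ln (1 + a) - ln (1 - a).
Proof.
intros Ha. unfold artanh. rewrite ln_div by lra. field.
Qed.

Lemma artanh_pos (a : R) : 0 < a < 1 -> 0 < 2 * artanh a.
Proof.
intros Ha. rewrite two_artanh by lra.
enough (ln (1 - a) < ln (1 + a)) by lra. apply ln_increasing; lra.
Qed.

Lemma ln_orbit_step (h : R -> R) (x : nat -> R) (n : nat) :
  positive_continuous h -> midpoint_orbit h x ->
  ln (x (S n)) - ln (x n) = - (2 * artanh (half_slope h x n)).
Proof.
intros Hh Hx. pose proof (half_slope_bounds h x n Hh Hx) as Hc.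
destruct (Hx n) as [H0 _], (Hx (S n)) as [H1 _].
rewrite <- ln_div, (orbit_ratio h), ln_div, two_artanh by (assumption || lra).
ring.
Qed.

Lemma ln_orbit_div_INR (h : R -> R) (x : nat -> R) (a : R) :
  positive_continuous h -> midpoint_orbit h x -> 0 < a < 1 ->
  is_lim_seq (half_slope h x) a ->
  is_lim_seq (fun n => ln (x n) / INR n) (- (2 * artanh a)).
Proof.
intros Hh Hx Ha Hl. apply is_lim_seq_div_INR.
apply is_lim_seq_ext with (fun n => ln (x (S n) / x n)).
{ intros n. apply ln_div; apply Hx. }
replace (- (2 * artanh a)) with (ln ((1 - a) / (1 + a))).
2: { rewrite two_artanh, ln_div by lra. ring. }
apply is_lim_seq_continuous; [|apply (orbit_ratio_lim h); (assumption || lra)].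
apply derivable_continuous_pt. exists (/ ((1 - a) / (1 + a))).
apply derivable_pt_lim_ln, Rdiv_lt_0_compat; lra.
Qed.

Lemma ln_minus_le (u v m : R) :
  0 < m -> m <= u -> m <= v -> Rabs (ln u - ln v) <= Rabs (u - v) / m.
Proof.
assert (Hone : forall u v, 0 < m -> m <= u -> m <= v -> v <= u ->
  Rabs (ln u - ln v) <= Rabs (u - v) / m).
{ clear u v. intros u v Hm Hu Hv Huv.
  assert (Hl : ln v <= ln u) by (apply ln_le; lra).
  rewrite !Rabs_right by lra.
  rewrite <- ln_div by lra.
  assert (He : u / v <= exp (u / v - 1)).
  { pose proof (exp_ineq1_le (u / v - 1)). lra. }
  apply ln_le in He; [|apply Rdiv_lt_0_compat; lra].
  rewrite ln_exp in He. eapply Rle_trans; [exact He|].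
  replace (u / v - 1) with ((u - v) * / v) by (field; lra).
  apply Rmult_le_compat_l; [lra|]. apply Rinv_le_contravar; lra. }
intros Hm Hu Hv. destruct (Rle_dec v u) as [H|H]; [now apply Hone|].
rewrite Rabs_minus_sym, (Rabs_minus_sym u v). apply Hone; lra.
Qed.

Lemma artanh_lipschitz (r a : R) :
  0 < a < 1 -> 0 <= r <= (1 + a) / 2 ->
  Rabs (2 * artanh r - 2 * artanh a) <= (1 + 2 / (1 - a)) * Rabs (r - a).
Proof.
intros Ha Hr. rewrite !two_artanh by lra.
replace (ln (1 + r) - ln (1 - r) - (ln (1 + a) - ln (1 - a)))
  with ((ln (1 + r) - ln (1 + a)) - (ln (1 - r) - ln (1 - a))) by ring.
eapply Rle_trans; [apply Rabs_triang|]. rewrite Rabs_Ropp.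
assert (H1 : Rabs (ln (1 + r) - ln (1 + a)) <= Rabs (1 + r - (1 + a)) / 1)
  by (apply ln_minus_le; lra).
assert (H2 : Rabs (ln (1 - r) - ln (1 - a))
             <= Rabs (1 - r - (1 - a)) / ((1 - a) / 2))
  by (apply ln_minus_le; lra).
replace (1 + r - (1 + a)) with (r - a) in H1 by ring.
replace (1 - r - (1 - a)) with (- (r - a)) in H2 by ring.
rewrite Rabs_Ropp in H2.
replace ((1 + 2 / (1 - a)) * Rabs (r - a))
  with (Rabs (r - a) / 1 + Rabs (r - a) / ((1 - a) / 2)) by (field; lra).
lra.
Qed.

(** The defects of [ln (x n)] from an arithmetic progression of step
    [- 2 * artanh a] are summable, since [artanh] is Lipschitz away from [1]. *)
Lemma ln_orbit_bounded (h : R -> R) (x p : nat -> R) (a : R) :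
  positive_continuous h -> midpoint_orbit h x -> 0 < a < 1 ->
  is_lim_seq (half_slope h x) a ->
  eventually (fun n => Rabs (half_slope h x n - a) <= p n) -> ex_series p ->
  exists M, forall n, Rabs (ln (x n) + 2 * artanh a * INR n) <= M.
Proof.
intros Hh Hx Ha Hl Hp Hs.
apply bounded_of_ex_series_increments with
  (p := fun n => (1 + 2 / (1 - a)) * p n).
2: exact (ex_series_scal (V := R_NormedModule) (1 + 2 / (1 - a)) p Hs).
assert (He : eventually (fun n => Rabs (half_slope h x n - a) < (1 - a) / 2))
  by (apply eventually_close; [exact Hl|lra]).
generalize (filter_and _ _ Hp He). apply filter_imp. intros n [H1 H2].
replace (ln (x (S n)) + 2 * artanh a * INR (S n)
         - (ln (x n) + 2 * artanh a * INR n))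
  with (- (2 * artanh (half_slope h x n) - 2 * artanh a)).
2: { pose proof (ln_orbit_step h x n Hh Hx). rewrite S_INR. lra. }
rewrite Rabs_Ropp.
pose proof (half_slope_bounds h x n Hh Hx) as Hc.
apply Rabs_lt_between in H2.
eapply Rle_trans; [apply artanh_lipschitz; lra|].
apply Rmult_le_compat_l; [|exact H1].
assert (0 < 2 / (1 - a)) by (apply Rdiv_lt_0_compat; lra). lra.
Qed.

(** The ratio test: the ratio of successive terms of [exp (C n) * x n] is
    [exp C] times that of [x]. *)
Lemma exp_mul_lim_0 (x : nat -> R) (C : R) :
  (forall n, 0 < x n) -> is_lim_seq (fun n => x (S n) / x n) 0 ->
  is_lim_seq (fun n => exp (C * INR n) * x n) 0.
Proof.
intros Hx Hr.
assert (Hpos : forall n, 0 < exp (C * INR n) * x n).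
{ intros n. apply Rmult_lt_0_compat; [apply exp_pos|apply Hx]. }
apply is_lim_seq_abs_0.
apply (ex_series_lim_0 (fun n => Rabs (exp (C * INR n) * x n))).
apply ex_series_DAlembert with 0; [lra| |].
{ intros n. specialize (Hpos n). lra. }
apply is_lim_seq_ext with (fun n => exp C * (x (S n) / x n)).
{ intros n. rewrite Rabs_right.
  - rewrite S_INR, Rmult_plus_distr_l, Rmult_1_r, exp_plus.
    pose proof (exp_pos (C * INR n)). specialize (Hx n). field. lra.
  - apply Rle_ge, Rlt_le, Rdiv_lt_0_compat; apply Hpos. }
replace (Finite 0) with (Finite (exp C * 0)) by (f_equal; ring).
apply is_lim_seq_mult'; [apply is_lim_seq_const|exact Hr].
Qed.

(** [v n = ln (x n) + ln K / alpha] satisfies [v (S n) <= (1 + alpha) * v n],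
    and it is negative from some index on. *)
Lemma superexponential_decay (x : nat -> R) (K alpha : R) :
  (forall n, 0 < x n) -> is_lim_seq x 0 -> 0 < K -> 0 < alpha ->
  eventually (fun n => x (S n) <= K * Rpower (x n) (1 + alpha)) ->
  exists mu, 0 < mu /\
    eventually (fun n =>
      x n <= Rpower K (- (1 / alpha)) * exp (- mu * (1 + alpha) ^ n)).
Proof.
intros Hx Hl HK Ha Hstep.
set (v := fun n => ln (x n) + ln K / alpha).
assert (Hsmall : eventually (fun n => x n < Rpower K (- (1 / alpha)))).
{ assert (HR : 0 < Rpower K (- (1 / alpha))) by apply exp_pos.
  generalize (eventually_close _ _ _ Hl HR). apply filter_imp.
  intros n Hn. apply Rabs_lt_between in Hn. lra. }
destruct (filter_and _ _ Hstep Hsmall) as [N HN].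
assert (HvN : v N < 0).
{ destruct (HN N (le_n N)) as [_ H]. apply ln_increasing in H; [|apply Hx].
  rewrite ln_Rpower in H. unfold v.
  replace (ln K / alpha) with (- (- (1 / alpha) * ln K)) by (field; lra). lra. }
assert (Hrec : forall k, v (N + k)%nat <= (1 + alpha) ^ k * v N).
{ induction k as [|k IH].
  - rewrite Nat.add_0_r. simpl. lra.
  - destruct (HN (N + k)%nat) as [H _]; [lia|].
    apply ln_le in H; [|apply Hx].
    rewrite ln_mult, ln_Rpower in H by (assumption || apply exp_pos).
    apply Rle_trans with ((1 + alpha) * v (N + k)%nat).
    + rewrite Nat.add_succ_r. unfold v.
      replace ((1 + alpha) * (ln (x (N + k)%nat) + ln K / alpha))
        with (ln K + (1 + alpha) * ln (x (N + k)%nat) + ln K / alpha)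
        by (field; lra). lra.
    + simpl. rewrite Rmult_assoc. apply Rmult_le_compat_l; lra. }
assert (HpN : 0 < (1 + alpha) ^ N) by (apply pow_lt; lra).
exists (- v N / (1 + alpha) ^ N). split; [apply Rdiv_lt_0_compat; lra|].
exists N. intros n Hn. replace n with (N + (n - N))%nat by lia.
specialize (Hrec (n - N)%nat). set (k := (n - N)%nat) in *.
rewrite <- (exp_ln (x (N + k)%nat)) by apply Hx.
unfold Rpower. rewrite <- exp_plus. apply exp_nondecreasing.
rewrite pow_add.
replace (- (- v N / (1 + alpha) ^ N) * ((1 + alpha) ^ N * (1 + alpha) ^ k))
  with ((1 + alpha) ^ k * v N) by (field; lra).
unfold v in Hrec at 1.
replace (- (1 / alpha) * ln K) with (- (ln K / alpha)) by (field; lra). lra.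
Qed.

(** * The iterates of [Qmap q] form a midpoint orbit *)

Lemma is_derive_of_interior (D : R -> Prop) (f : R -> R) (x l : R) :
  locally x D -> is_derive_on D f x l -> is_derive f x l.
Proof.
intros HD [Hlin Hdom]. split; [exact Hlin|]. intros y Hy.
apply (is_filter_lim_locally_unique (V := R_NormedModule)) in Hy. subst y.
intros eps. specialize (Hdom x (filter_le_within (F := locally _) _) eps).
unfold within in Hdom.
generalize (filter_and _ _ HD Hdom). apply filter_imp. intros y [H1 H2].
now apply H2.
Qed.

Lemma locally_nonneg (x : R) : 0 < x -> locally x nonneg_reals.
Proof.
intros Hx. exists (mkposreal x Hx). intros y Hy.
change (Rabs (y - x) < x) in Hy. apply Rabs_lt_between in Hy.
unfold nonneg_reals. lra.
Qed.

Lemma slope_at_right_0 (f : R -> R) (l : R) :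
  is_derive_on nonneg_reals f 0 l -> f 0 = 0 ->
  filterlim (fun s => f s / s) (at_right 0) (locally l).
Proof.
intros [_ Hdom] H0 P [[e He] HP].
assert (He2 : 0 < e / 2) by lra.
specialize (Hdom 0 (filter_le_within (F := locally _) _) (mkposreal _ He2)).
unfold within in Hdom. unfold filtermap, at_right, within.
generalize Hdom. apply filter_imp. intros s Hs Hpos.
specialize (Hs (Rlt_le _ _ Hpos)). apply HP. change (Rabs (f s / s - l) < e).
change (Rabs (f s - f 0 - (s - 0) * l) <= e / 2 * Rabs (s - 0)) in Hs.
rewrite H0, !Rminus_0_r, (Rabs_right s) in Hs by lra.
replace (f s / s - l) with ((f s - s * l) / s) by (field; lra).
rewrite Rabs_div, (Rabs_right s) by lra.
apply Rmult_lt_reg_r with s; [exact Hpos|].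
replace (Rabs (f s - s * l) / s * s) with (Rabs (f s - s * l)) by (field; lra).
assert (0 < e * s) by now apply Rmult_lt_0_compat. lra.
Qed.

Lemma sqrt2_pos : 0 < sqrt 2.
Proof. apply sqrt_lt_R0. lra. Qed.

Lemma sqrt2_sq : sqrt 2 * sqrt 2 = 2.
Proof. apply sqrt_sqrt. lra. Qed.

Lemma sqrt2_gt_1 : 1 < sqrt 2.
Proof. rewrite <- sqrt_1. apply sqrt_lt_1; lra. Qed.


Lemma is_derive_interior (q q' : R -> R) (x : R) :
  is_C1_on nonneg_reals q q' -> 0 < x -> is_derive q x (q' x).
Proof.
intros [Hd _] Hx. apply (is_derive_of_interior nonneg_reals).
- now apply locally_nonneg.
- apply Hd. unfold nonneg_reals. lra.
Qed.

Lemma continuous_interior (q q' : R -> R) (x : R) :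
  is_C1_on nonneg_reals q q' -> 0 < x -> continuous q x.
Proof.
intros HC Hx. apply (ex_derive_continuous (V := R_NormedModule)).
exists (q' x). now apply is_derive_interior.
Qed.

Lemma qbar_positive_continuous (q q' : R -> R) :
  is_C1_on nonneg_reals q q' ->
  (forall x, 0 < x -> 0 < q x < x) -> positive_continuous (qbar q).
Proof.
intros HC Hq s Hs. pose proof sqrt2_pos as H2.
assert (H2s : 0 < sqrt 2 * s) by now apply Rmult_lt_0_compat.
destruct (Hq _ H2s) as [Hq1 _]. unfold qbar. split.
- now apply Rmult_lt_0_compat.
- apply (continuous_scal_r (V := R_NormedModule) (sqrt 2)).
  apply (continuous_comp (fun s => sqrt 2 * s) q).
  + apply (continuous_scal_r (V := R_NormedModule) (sqrt 2)), continuous_id.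
  + now apply (continuous_interior q q').
Qed.

(** [q t + t] is at most [y] at [t = y / 2] and at least [y] at [t = y]. *)
Lemma inv_q_plus_id (q q' : R -> R) (y : R) :
  is_C1_on nonneg_reals q q' -> (forall x, 0 < x -> 0 < q x < x) -> 0 < y ->
  let t := inv_on nonneg_reals (fun t => q t + t) y in
  0 <= t /\ q t + t = y.
Proof.
intros HC Hq Hy.
apply (inv_on_spec nonneg_reals (fun t => q t + t) y).
destruct (Ranalysis5.f_interv_is_interv (fun t => q t + t) (y / 2) y y)
  as (t & Ht & Hty).
- lra.
- pose proof (Hq y Hy). assert (Hy2 : 0 < y / 2) by lra.
  pose proof (Hq (y / 2) Hy2). lra.
- intros t Ht. apply continuity_pt_plus.
  2: apply derivable_continuous_pt, derivable_pt_id.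
  apply continuity_pt_filterlim, (continuous_interior q q'); [exact HC|lra].
- exists t. split; [unfold nonneg_reals; lra|exact Hty].
Qed.

(** With [t = inv (q + Id) (sqrt 2 * x)], the points [x] and [Q x] are
    [(t + q t) / sqrt 2] and [(t - q t) / sqrt 2]: their midpoint is
    [t / sqrt 2] and their difference [sqrt 2 * q t]. *)
Lemma Qmap_midpoint (q q' : R -> R) (x : R) :
  is_C1_on nonneg_reals q q' -> (forall x, 0 < x -> 0 < q x < x) -> q 0 = 0 ->
  0 < x -> 0 < Qmap q x /\ x - Qmap q x = qbar q ((x + Qmap q x) / 2).
Proof.
intros HC Hq H0 Hx. pose proof sqrt2_pos as H2. pose proof sqrt2_sq as H22.
assert (H2x : 0 < sqrt 2 * x) by now apply Rmult_lt_0_compat.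
destruct (inv_q_plus_id q q' _ HC Hq H2x) as [Ht1 Ht2].
unfold Qmap. set (t := inv_on nonneg_reals (fun t => q t + t) (sqrt 2 * x)) in *.
assert (Ht : 0 < t).
{ destruct Ht1 as [|Ht1]; [easy|]. rewrite <- Ht1, H0 in Ht2. lra. }
rewrite <- Ht2.
assert (Hi : / sqrt 2 = sqrt 2 / 2).
{ apply Rmult_eq_reg_l with (sqrt 2); [|lra]. rewrite Rinv_r by lra.
  unfold Rdiv. rewrite <- Rmult_assoc, H22. field. }
assert (Hx' : x = sqrt 2 / 2 * (q t + t)).
{ rewrite Ht2, <- Hi. field. lra. }
destruct (Hq t Ht) as [Hq1 Hq2].
split.
- rewrite Rdiv_1_l. apply Rmult_lt_0_compat; [now apply Rinv_0_lt_compat|lra].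
- unfold qbar. rewrite Rdiv_1_l, Hi, Hx'.
  replace (sqrt 2 * ((sqrt 2 / 2 * (q t + t)
            + sqrt 2 / 2 * (2 * t - (q t + t))) / 2))
    with (sqrt 2 * sqrt 2 / 2 * t) by field.
  rewrite H22. replace (2 / 2 * t) with t by field. field.
Qed.

Lemma Qmap_orbit (q q' : R -> R) (x0 : R) :
  is_C1_on nonneg_reals q q' -> (forall x, 0 < x -> 0 < q x < x) -> q 0 = 0 ->
  0 < x0 -> midpoint_orbit (qbar q) (fun n => Nat.iter n (Qmap q) x0).
Proof.
intros HC Hq H0 Hx0.
assert (Hpos : forall n, 0 < Nat.iter n (Qmap q) x0).
{ induction n as [|n IH]; [exact Hx0|]. now apply (Qmap_midpoint q q'). }
intros n. split; [apply Hpos|]. now apply (Qmap_midpoint q q').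
Qed.

Lemma half_slope_qbar (q : R -> R) (s : R) :
  0 < s -> qbar q s / (2 * s) = q (sqrt 2 * s) / (sqrt 2 * s).
Proof.
intros Hs. pose proof sqrt2_pos. unfold qbar.
replace (2 * s) with (sqrt 2 * (sqrt 2 * s))
  by (rewrite <- Rmult_assoc, sqrt2_sq; reflexivity).
field. lra.
Qed.

Lemma half_slope_qbar_lim (q q' : R -> R) :
  is_C1_on nonneg_reals q q' -> q 0 = 0 ->
  filterlim (fun s => qbar q s / (2 * s)) (at_right 0) (locally (q' 0)).
Proof.
intros HC H0.
apply (filterlim_ext_loc (fun s => q (sqrt 2 * s) / (sqrt 2 * s))).
{ exists (mkposreal 1 Rlt_0_1). intros s _ Hs. symmetry. now apply half_slope_qbar. }
apply (filterlim_comp _ _ _ (fun s => sqrt 2 * s) (fun t => q t / t) _ (at_right 0) _).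
2: { apply slope_at_right_0; [|exact H0]. apply HC. apply Rle_refl. }
intros P [[d Hd] HP]. pose proof sqrt2_pos as H2.
assert (Hd2 : 0 < d / sqrt 2) by now apply Rdiv_lt_0_compat.
exists (mkposreal _ Hd2). intros s Hs Hpos. apply HP; [|now apply Rmult_lt_0_compat].
change (Rabs (s - 0) < d / sqrt 2) in Hs. change (Rabs (sqrt 2 * s - 0) < d).
rewrite Rminus_0_r in *. rewrite Rabs_mult, (Rabs_right (sqrt 2)) by lra.
replace d with (sqrt 2 * (d / sqrt 2)) by (field; lra).
now apply Rmult_lt_compat_l.
Qed.

(** Mean value theorem, with [q'] small near [0] by continuity. *)
Lemma qbar_small_lipschitz (q q' : R -> R) :
  is_C1_on nonneg_reals q q' -> q' 0 = 0 ->
  forall eps, 0 < eps -> exists d, 0 < d /\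
    forall s t, 0 < s < d -> 0 < t < d ->
      Rabs (qbar q s - qbar q t) <= eps * Rabs (s - t).
Proof.
intros HC H0 eps He. pose proof sqrt2_pos as H2. pose proof sqrt2_sq as H22.
assert (He2 : 0 < eps / 2) by lra.
destruct (proj2 HC 0 (Rle_refl 0) (fun y => Rabs y < eps / 2)) as [d Hd].
{ rewrite H0. exists (mkposreal _ He2). intros y Hy.
  change (Rabs (y - 0) < eps / 2) in Hy. now rewrite Rminus_0_r in Hy. }
exists (d / sqrt 2). split; [apply Rdiv_lt_0_compat; [apply cond_pos|lra]|].
intros s t Hs Ht.
assert (Hsc : forall s, 0 < s < d / sqrt 2 -> 0 < sqrt 2 * s < d).
{ intros u Hu. split; [now apply Rmult_lt_0_compat|].
  replace (pos d) with (sqrt 2 * (d / sqrt 2)) by (field; lra).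
  now apply Rmult_lt_compat_l. }
apply Hsc in Hs as Hs'. apply Hsc in Ht as Ht'.
destruct (MVT_gen q (sqrt 2 * t) (sqrt 2 * s) q') as (c & Hc & Hmv).
- intros c Hc. apply is_derive_interior; [exact HC|].
  assert (0 < Rmin (sqrt 2 * t) (sqrt 2 * s)) by now apply Rmin_glb_lt. lra.
- intros c Hc. apply continuity_pt_filterlim, (continuous_interior q q'); [exact HC|].
  assert (0 < Rmin (sqrt 2 * t) (sqrt 2 * s)) by now apply Rmin_glb_lt. lra.
- assert (Hcd : 0 < c < d).
  { assert (0 < Rmin (sqrt 2 * t) (sqrt 2 * s)) by now apply Rmin_glb_lt.
    assert (Rmax (sqrt 2 * t) (sqrt 2 * s) < d) by now apply Rmax_lub_lt. lra. }
  assert (Hq' : Rabs (q' c) < eps / 2).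
  { apply Hd; [|unfold nonneg_reals; lra]. change (Rabs (c - 0) < d).
    rewrite Rminus_0_r, Rabs_right; lra. }
  unfold qbar. rewrite <- Rmult_minus_distr_l, Hmv, <- Rmult_minus_distr_l.
  replace (sqrt 2 * (q' c * (sqrt 2 * (s - t))))
    with (sqrt 2 * sqrt 2 * q' c * (s - t)) by ring.
  rewrite H22, !Rabs_mult, (Rabs_right 2) by lra.
  apply Rmult_le_compat_r; [apply Rabs_pos|lra].
Qed.

Lemma psi_ge (q : R -> R) (l r s : R) :
  (forall x, 0 < x -> 0 < q x < x) -> 0 < l < 1 -> 0 < s <= r ->
  Rabs (q s / s - l) <= psi q l r.
Proof.
intros Hq Hl Hs. unfold psi.
set (E := fun y => exists s, 0 < s <= r /\ y = Rabs (q s / s - l)).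
destruct (Lub_Rbar_correct E) as [Hub Hleast].
assert (HE : E (Rabs (q s / s - l))) by now exists s.
assert (Hb : is_ub_Rbar E 1).
{ intros y (u & Hu & ->). simpl.
  assert (Hq1 : 0 < q u / u) by (apply Rdiv_lt_0_compat; [apply Hq|]; lra).
  assert (Hq2 : q u / u < 1).
  { apply Rmult_lt_reg_r with u; [lra|].
    replace (q u / u * u) with (q u) by (field; lra). rewrite Rmult_1_l.
    apply Hq; lra. }
  apply Rabs_le. lra. }
specialize (Hub _ HE). specialize (Hleast _ Hb).
destruct (Lub_Rbar E) as [b| |]; simpl in *; easy.
Qed.

(** * The three regimes *)

Lemma Qmap_orbit_elapsed_equiv (q q' : R -> R) (x0 : R) :
  is_C1_on nonneg_reals q q' -> (forall x, 0 < x -> 0 < q x < x) -> q 0 = 0 ->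
  0 < x0 -> q' 0 = 0 ->
  seq_equiv (fun n => F_int q x0 (Nat.iter n (Qmap q) x0)) INR.
Proof.
intros HC Hq H0 Hx0 Hq'0. apply is_lim_seq_div_INR.
apply (elapsed_midpoint_step (qbar q) (fun n => Nat.iter n (Qmap q) x0)).
- now apply (qbar_positive_continuous q q').
- now apply (Qmap_orbit q q').
- exact Hx0.
- now apply (qbar_small_lipschitz q q').
Qed.

Lemma Qmap_orbit_le (q q' : R -> R) (x0 : R) (n : nat) :
  is_C1_on nonneg_reals q q' -> (forall x, 0 < x -> 0 < q x < x) -> q 0 = 0 ->
  0 < x0 -> 0 < Nat.iter n (Qmap q) x0 <= x0.
Proof.
intros HC Hq H0 Hx0.
pose proof (qbar_positive_continuous q q' HC Hq) as Hh.
pose proof (Qmap_orbit q q' x0 HC Hq H0 Hx0) as Ho.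
split; [apply Ho|].
induction n as [|n IH]; [apply Rle_refl|].
pose proof (midpoint_between _ _ n Hh Ho) as [H1 H2]. cbv beta in *. lra.
Qed.

(** [F] reaches every integer because it is continuous, vanishes at [x0] and is
    unbounded along the orbit. *)
Lemma Finv_spec (q q' : R -> R) (x0 : R) (n : nat) :
  is_C1_on nonneg_reals q q' -> (forall x, 0 < x -> 0 < q x < x) -> q 0 = 0 ->
  0 < x0 -> q' 0 = 0 ->
  0 < Finv q x0 (INR n) <= x0 /\ F_int q x0 (Finv q x0 (INR n)) = INR n.
Proof.
intros HC Hq H0 Hx0 Hq'0.
apply (inv_on_spec (fun z => 0 < z <= x0) (F_int q x0) (INR n)).
pose proof (qbar_positive_continuous q q' HC Hq) as Hh.
destruct n as [|n].
{ exists x0. split; [lra|]. apply elapsed_refl. }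
assert (Hhalf : 0 < / 2) by lra.
destruct (eventually_close _ _ _
  (Qmap_orbit_elapsed_equiv q q' x0 HC Hq H0 Hx0 Hq'0) Hhalf) as [N HN].
set (k := (N + 2 * S n)%nat).
assert (Hk : INR (2 * S n) <= INR k) by (apply le_INR; unfold k; lia).
specialize (HN k). rewrite mult_INR in Hk. change (INR 2) with 2 in Hk.
assert (Hn : 0 < INR (S n)) by (apply lt_0_INR; lia).
assert (HF : INR (S n) <= F_int q x0 (Nat.iter k (Qmap q) x0)).
{ assert (Hr : Rabs (F_int q x0 (Nat.iter k (Qmap q) x0) / INR k - 1) < / 2)
    by (apply HN; unfold k; lia).
  apply Rabs_lt_between in Hr.
  set (r := F_int q x0 (Nat.iter k (Qmap q) x0) / INR k) in *.
  replace (F_int q x0 (Nat.iter k (Qmap q) x0)) with (r * INR k)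
    by (unfold r; field; lra). nra. }
destruct (Qmap_orbit_le q q' x0 k HC Hq H0 Hx0) as [Hp [Hlt|Heq]].
- destruct (elapsed_surj (qbar q) x0 _ (INR (S n)) Hh (conj Hp Hlt)) as (y & Hy).
  { split; [lra|exact HF]. }
  now exists y.
- rewrite Heq in HF. change (INR (S n) <= elapsed (qbar q) x0 x0) in HF.
  rewrite elapsed_refl in HF. lra.
Qed.

Lemma Qmap_orbit_equiv_Finv (q q' : R -> R) (x0 C : R) :
  is_C1_on nonneg_reals q q' -> (forall x, 0 < x -> 0 < q x < x) -> q 0 = 0 ->
  0 < x0 -> q' 0 = 0 -> 0 < C ->
  (forall z, 0 < z <= x0 -> F_int q x0 z * qbar q z / z <= C) ->
  seq_equiv (fun n => Nat.iter n (Qmap q) x0) (fun n => Finv q x0 (INR n)).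
Proof.
intros HC Hq H0 Hx0 Hq'0 HCpos Hbd.
pose proof (fun n => Finv_spec q q' x0 n HC Hq H0 Hx0 Hq'0) as Hy.
apply (seq_equiv_of_elapsed (qbar q) x0 C).
- now apply (qbar_positive_continuous q q').
- exact HCpos.
- exact Hbd.
- intros n. now apply (Qmap_orbit_le q q').
- intros n. apply Hy.
- exists 1%nat. intros n Hn. change (0 < F_int q x0 (Finv q x0 (INR n))).
  rewrite (proj2 (Hy n)). apply lt_0_INR. lia.
- unfold seq_equiv.
  apply is_lim_seq_ext with
    (fun n => F_int q x0 (Nat.iter n (Qmap q) x0) / INR n).
  { intros n. now rewrite <- (proj2 (Hy n)) at 1. }
  now apply (Qmap_orbit_elapsed_equiv q q').
Qed.

(** Since [ln (x n)] is equivalent to [- lambda * n], the orbit is eventually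
    below [exp (- lambda * n / 2)], with enough room for the factor [sqrt 2]. *)
Lemma half_slope_defect_le_psi (q q' : R -> R) (x0 : R) :
  is_C1_on nonneg_reals q q' -> (forall x, 0 < x -> 0 < q x < x) -> q 0 = 0 ->
  0 < x0 -> 0 < q' 0 < 1 ->
  eventually (fun n =>
    Rabs (half_slope (qbar q) (fun n => Nat.iter n (Qmap q) x0) n - q' 0)
    <= psi q (q' 0) (exp (- (2 * artanh (q' 0) / 2) * INR n))).
Proof.
intros HC Hq H0 Hx0 Ha.
pose proof (qbar_positive_continuous q q' HC Hq) as Hh.
pose proof (Qmap_orbit q q' x0 HC Hq H0 Hx0) as Ho.
pose proof (half_slope_lim _ _ _ Hh Ho (half_slope_qbar_lim q q' HC H0)) as Hl.
pose proof (ln_orbit_div_INR _ _ _ Hh Ho Ha Hl) as Hln.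
set (x := fun n => Nat.iter n (Qmap q) x0) in *.
set (a := q' 0) in *. set (lam := 2 * artanh a) in *.
assert (Hlam : 0 < lam) by now apply artanh_pos.
assert (H4 : 0 < lam / 4) by lra.
destruct (nfloor_ex (4 / lam * ln (sqrt 2))) as [N [_ HN]].
{ apply Rmult_le_pos; [apply Rlt_le, Rdiv_lt_0_compat; lra|].
  rewrite <- ln_1. apply ln_le; [lra|]. apply Rlt_le, sqrt2_gt_1. }
assert (Hlarge : eventually (fun n => 0 < INR n /\ ln (sqrt 2) <= lam / 4 * INR n)).
{ exists (S N). intros n Hn. apply le_INR in Hn. rewrite S_INR in Hn.
  pose proof (pos_INR N). split; [lra|].
  apply Rmult_le_reg_l with (4 / lam); [apply Rdiv_lt_0_compat; lra|].
  replace (4 / lam * (lam / 4 * INR n)) with (INR n) by (field; lra). lra. }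
generalize (filter_and _ _ Hlarge (eventually_close _ _ _ Hln H4)).
apply filter_imp. intros n [[Hn Hs2] Hr].
destruct (midpoint_between _ _ n Hh Ho) as [Hm1 Hm2].
assert (Hxn : ln (x n) <= - (lam * 3 / 4) * INR n).
{ apply Rabs_lt_between in Hr. set (r := ln (x n) / INR n) in *.
  replace (ln (x n)) with (r * INR n) by (unfold r; field; lra).
  apply Rmult_le_compat_r; lra. }
unfold half_slope. rewrite half_slope_qbar by lra.
apply psi_ge; [exact Hq|exact Ha|]. pose proof sqrt2_pos as H2.
split; [apply Rmult_lt_0_compat; lra|].
apply Rle_trans with (sqrt 2 * x n); [apply Rmult_le_compat_l; lra|].
rewrite <- (exp_ln (sqrt 2 * x n)) by (apply Rmult_lt_0_compat; lra).
apply exp_nondecreasing. rewrite ln_mult by lra. lra.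
Qed.

Lemma Qmap_orbit_exponential (q q' : R -> R) (x0 : R) :
  is_C1_on nonneg_reals q q' -> (forall x, 0 < x -> 0 < q x < x) -> q 0 = 0 ->
  0 < x0 -> 0 < q' 0 < 1 ->
  let lambda := 2 * artanh (q' 0) in
  ex_series (fun k => psi q (q' 0) (exp (- (lambda / 2) * INR k))) ->
  exists C, 1 < C /\ forall n : nat,
    / C * exp (- lambda * INR n) <= Nat.iter n (Qmap q) x0
      <= C * exp (- lambda * INR n).
Proof.
intros HC Hq H0 Hx0 Ha lambda Hs.
pose proof (qbar_positive_continuous q q' HC Hq) as Hh.
pose proof (Qmap_orbit q q' x0 HC Hq H0 Hx0) as Ho.
pose proof (half_slope_lim _ _ _ Hh Ho (half_slope_qbar_lim q q' HC H0)) as Hl.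
destruct (ln_orbit_bounded _ _ _ _ Hh Ho Ha Hl
  (half_slope_defect_le_psi q q' x0 HC Hq H0 Hx0 Ha) Hs) as [M HM].
assert (HM0 : 0 <= M) by (eapply Rle_trans; [apply Rabs_pos|apply (HM O)]).
exists (exp (M + 1)). split.
{ rewrite <- exp_0 at 1. apply exp_increasing. lra. }
intros n. specialize (HM n). apply Rabs_le_between in HM.
fold lambda in HM. destruct (Ho n) as [Hpos _].
rewrite <- (exp_ln (Nat.iter n (Qmap q) x0)) by exact Hpos.
rewrite <- exp_Ropp, <- !exp_plus. split; apply exp_nondecreasing; lra.
Qed.

Lemma Qmap_orbit_superexponential (q q' : R -> R) (x0 Cs alpha xs : R) :
  is_C1_on nonneg_reals q q' -> (forall x, 0 < x -> 0 < q x < x) -> q 0 = 0 ->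
  0 < x0 -> 0 < Cs -> 0 < alpha -> 0 < xs ->
  (forall x, 0 <= x <= xs ->
     Rabs (q x - x)
       <= Cs * Rpower 2 (- (alpha / 2)) * pow_real (Rabs x) (1 + alpha)) ->
  exists mu, 0 < mu /\
    eventually (fun n =>
      Nat.iter n (Qmap q) x0
        <= Rpower Cs (- (1 / alpha)) * exp (- mu * (1 + alpha) ^ n)).
Proof.
intros HC Hq H0 Hx0 HCs Hal Hxs Hbd.
pose proof (qbar_positive_continuous q q' HC Hq) as Hh.
pose proof (Qmap_orbit q q' x0 HC Hq H0 Hx0) as Ho.
pose proof (midpoint_orbit_lim _ _ Hh Ho) as Hl.
pose proof sqrt2_pos as H2. pose proof sqrt2_sq as H22.
apply (superexponential_decay (fun n => Nat.iter n (Qmap q) x0) Cs alpha);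
  [intros n; apply Ho|exact Hl|exact HCs|exact Hal|].
set (x := fun n => Nat.iter n (Qmap q) x0) in *.
assert (Hxs2 : 0 < xs / sqrt 2) by now apply Rdiv_lt_0_compat.
generalize (eventually_close _ _ _ Hl Hxs2). apply filter_imp. intros n Hn.
destruct (midpoint_between _ _ n Hh Ho) as [[Hm0 Hm1] Hm2].
destruct (Ho n) as [Hpos Hstep].
change (Qmap q (Nat.iter n (Qmap q) x0)) with (x (S n)).
change (Nat.iter n (Qmap q) x0) with (x n).
set (m := midpoint x n) in *.
rewrite Rminus_0_r, Rabs_right in Hn by lra.
assert (Ht : 0 < sqrt 2 * m) by (apply Rmult_lt_0_compat; lra).
specialize (Hbd (sqrt 2 * m)).
unfold pow_real in Hbd. rewrite (Rabs_right (sqrt 2 * m)) in Hbd by lra.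
destruct (Req_EM_T (sqrt 2 * m) 0) as [He|_]; [lra|].
assert (Hq' := Hq _ Ht).
rewrite Rabs_left in Hbd by lra.
assert (Hbd' : - (q (sqrt 2 * m) - sqrt 2 * m)
  <= Cs * Rpower 2 (- (alpha / 2)) * Rpower (sqrt 2 * m) (1 + alpha)).
{ apply Hbd. split; [lra|].
  replace xs with (sqrt 2 * (xs / sqrt 2)) by (field; lra).
  apply Rmult_le_compat_l; lra. }
(* The powers of [2] cancel: [2 ^ (- alpha / 2) * (sqrt 2) ^ (1 + alpha)] is
   [sqrt 2]. *)
assert (Hpw : Rpower 2 (- (alpha / 2)) * Rpower (sqrt 2 * m) (1 + alpha)
              = sqrt 2 * Rpower m (1 + alpha)).
{ rewrite <- Rpower_mult_distr by lra.
  rewrite <- (Rpower_sqrt 2) by lra.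
  rewrite Rpower_mult, <- Rmult_assoc, <- Rpower_plus. do 2 f_equal. field. }
rewrite Rmult_assoc, Hpw in Hbd'.
assert (Hm : sqrt 2 * x (S n) = - (q (sqrt 2 * m) - sqrt 2 * m)).
{ assert (Hs : x (S n) = m - qbar q m / 2).
  { rewrite <- Hstep. unfold m, midpoint. field. }
  rewrite Hs. unfold qbar.
  replace (sqrt 2 * (m - sqrt 2 * q (sqrt 2 * m) / 2))
    with (sqrt 2 * m - (sqrt 2 * sqrt 2) * q (sqrt 2 * m) / 2) by field.
  rewrite H22. field. }
apply Rle_trans with (Cs * Rpower m (1 + alpha)).
- apply Rmult_le_reg_l with (sqrt 2); [exact H2|].
  change (sqrt 2 * x (S n) <= sqrt 2 * (Cs * Rpower m (1 + alpha))). lra.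
- apply Rmult_le_compat_l; [lra|]. apply Rle_Rpower_l; lra.
Qed.

Theorem proposition46 :
  forall (q q' : R -> R) (x0 : R),
    (forall x, 0 <= x -> 0 <= q x) ->
    is_C1_on nonneg_reals q q' ->
    q 0 = 0 ->
    (forall x, 0 < x -> 0 < q x < x /\ Rabs (q' x) < 1) ->
    0 < x0 ->
    (* (a) *)
    (q' 0 = 0 ->
       seq_equiv (fun n => F_int q x0 (Nat.iter n (Qmap q) x0)) INR /\
       ((exists C, 0 < C /\
           forall z, 0 < z <= x0 -> F_int q x0 z * qbar q z / z <= C) ->
        seq_equiv (fun n => Nat.iter n (Qmap q) x0)
                  (fun n => Finv q x0 (INR n)))) /\
    (* (b) *)
    (0 < q' 0 < 1 ->
       let lambda := 2 * artanh (q' 0) in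
       seq_equiv (fun n => ln (Nat.iter n (Qmap q) x0))
                 (fun n => - lambda * INR n) /\
       (ex_series (fun k => psi q (q' 0) (exp (- (lambda / 2) * INR k))) ->
        exists C, 1 < C /\
          forall n : nat,
            / C * exp (- lambda * INR n) <= Nat.iter n (Qmap q) x0
              <= C * exp (- lambda * INR n))) /\
    (* (c) *)
    (q' 0 = 1 ->
       (forall C, 0 < C ->
          is_lim_seq (fun n => exp (C * INR n) * Nat.iter n (Qmap q) x0) 0) /\
       (forall Cs alpha xs : R,
          0 < Cs -> 0 < alpha -> 0 < xs ->
          Cs * Rpower xs alpha < 1 ->
          (forall x, 0 <= x <= xs ->
             Rabs (q x - x)
               <= Cs * Rpower 2 (- (alpha / 2))
                    * pow_real (Rabs x) (1 + alpha)) ->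
          exists mu, 0 < mu /\
            eventually (fun n =>
              Nat.iter n (Qmap q) x0
                <= Rpower Cs (- (1 / alpha)) * exp (- mu * (1 + alpha) ^ n)))).
Proof.
intros q q' x0 _ HC H0 Hq' Hx0.
assert (Hq : forall x, 0 < x -> 0 < q x < x) by (intros x Hx; now apply Hq').
pose proof (qbar_positive_continuous q q' HC Hq) as Hh.
pose proof (Qmap_orbit q q' x0 HC Hq H0 Hx0) as Ho.
pose proof (half_slope_lim _ _ _ Hh Ho (half_slope_qbar_lim q q' HC H0)) as Hl.
split; [|split].
- intros Ha. split; [now apply (Qmap_orbit_elapsed_equiv q q')|].
  intros (C & HCpos & Hbd). now apply (Qmap_orbit_equiv_Finv q q' x0 C).
- intros Ha lambda. split; [|now apply (Qmap_orbit_exponential q q')].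
  assert (Hlam : 0 < lambda) by now apply artanh_pos.
  pose proof (ln_orbit_div_INR _ _ _ Hh Ho Ha Hl) as Hln.
  fold lambda in Hln. unfold seq_equiv.
  replace (Finite 1) with (Finite (- lambda / - lambda)) by (f_equal; field; lra).
  apply is_lim_seq_ext_loc with
    (fun n => ln (Nat.iter n (Qmap q) x0) / INR n / - lambda).
  { exists 1%nat. intros n Hn. field. split; [apply not_0_INR; lia|lra]. }
  apply is_lim_seq_div'; [exact Hln|apply is_lim_seq_const|lra].
- intros Ha. split.
  + intros C _. apply exp_mul_lim_0; [intros n; apply Ho|].
    replace (Finite 0) with (Finite ((1 - 1) / (1 + 1))) by (f_equal; field).
    rewrite Ha in Hl. apply (orbit_ratio_lim (qbar q)); (assumption || lra).
  + intros Cs alpha xs HCs Hal Hxs _ Hbd.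
    now apply (Qmap_orbit_superexponential q q' x0 Cs alpha xs).
Qed.
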